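(* Let $\mathtt{L}$ be a functional language and let $\mathcal{B}$ be a $\mathrm{u}_\omega$-compact $\mathtt{L}$-algebra. Then for every finitely generated $\mathtt{L}$-algebra $\mathcal{C}$ the following conditions are equivalent: 1) $\mathrm{Th}_{\forall}(\mathcal{B}) \subseteq \mathrm{Th}_{\forall}(\mathcal{C})$, i.e., $\mathcal{C} \in \mathbf{Ucl}(\mathcal{B})$; 2) $\mathrm{Th}_{\exists}(\mathcal{B}) \supseteq \mathrm{Th}_{\exists}(\mathcal{C})$; 3) $\mathcal{C}$ embeds into an ultrapower of $\mathcal{B}$; 4) $\mathcal{C}$ is discriminated by $\mathcal{B}$; 5) $\mathcal{C}$ is a limit algebra over $\mathcal{B}$; 6) $\mathcal{C}$ is an algebra defined by a complete atomic type in the theory $\mathrm{Th}_{\forall}(\mathcal{B})$ in $\mathtt{L}$; 7) $\mathcal{C}$ is (isomorphic to) the coordinate algebra of an irreducible algebraic set over $\mathcal{B}$ defined by a system of equations in the language $\mathtt{L}$. Moreover, if $\mathcal{B}$ is an $\mathtt{L}$-algebra such that for all finitely generated $\mathtt{L}$-algebras $\mathcal{C}$ the conditions 1)--7) are equivalent, then $\mathcal{B}$ is $\mathrm{u}_\omega$-compact.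
   Context: A functional language $\mathtt{L}$ is a first-order language with function and constant symbols only (and equality); $\mathtt{L}$-structures are called $\mathtt{L}$-algebras. For a finite set of variables $X=\{x_1,\dots,x_n\}$, $\mathcal{T}_{\mathtt{L}}(X)$ is the absolutely free algebra of terms, and $\mathrm{At}_{\mathtt{L}}(X)$ is the set of atomic formulas $(t=s)$ in variables $X$ (equations). A system of equations is a subset $S\subseteq \mathrm{At}_{\mathtt{L}}(X)$; $\mathrm{V}_{\mathcal{B}}(S)\subseteq B^n$ is its solution set in $\mathcal{B}$; sets of this form are the algebraic sets over $\mathcal{B}$. An algebraic set is irreducible if it is non-empty and is not a finite union of proper algebraic subsets. The radical $\mathrm{Rad}(Y)$ of an algebraic set $Y=\mathrm{V}_{\mathcal{B}}(S)$ is the largest system of equations in $\mathrm{At}_{\mathtt{L}}(X)$ with solution set $Y$, i.e. the set of all $(t=s)\in\mathrm{At}_{\mathtt{L}}(X)$ holding at all points of $Y$; it defines a congruence $\theta_{\mathrm{Rad}(Y)}$ on $\mathcal{T}_{\mathtt{L}}(X)$ ($t_1\sim t_2$ iff $(t_1=t_2)\in\mathrm{Rad}(Y)$), and $\Gamma(Y)=\mathcal{T}_{\mathtt{L}}(X)/\theta_{\mathrm{Rad}(Y)}$ is the coordinate algebra of $Y$. $\mathcal{B}$ is $\mathrm{u}_\omega$-compact if for any finite $X$, any $S\subseteq\mathrm{At}_{\mathtt{L}}(X)$ and any equations $(t_1=s_1),\dots,(t_m=s_m)\in\mathrm{At}_{\mathtt{L}}(X)$ with $\mathrm{V}_{\mathcal{B}}(S)\subseteq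 \mathrm{V}_{\mathcal{B}}(t_1=s_1)\cup\dots\cup\mathrm{V}_{\mathcal{B}}(t_m=s_m)$ there is a finite $S_0\subseteq S$ with $\mathrm{V}_{\mathcal{B}}(S_0)\subseteq \mathrm{V}_{\mathcal{B}}(t_1=s_1)\cup\dots\cup\mathrm{V}_{\mathcal{B}}(t_m=s_m)$. $\mathrm{Th}_\forall(\mathcal{B})$ and $\mathrm{Th}_\exists(\mathcal{B})$ are the sets of universal, respectively existential, sentences of $\mathtt{L}$ true in $\mathcal{B}$; $\mathbf{Ucl}(\mathcal{B})$ is the class of all models of $\mathrm{Th}_\forall(\mathcal{B})$. $\mathcal{C}$ is discriminated by $\mathcal{B}$ if for any finite $W\subseteq C$ there is a homomorphism $h\colon\mathcal{C}\to\mathcal{B}$ injective on $W$; by convention the trivial (one-element) algebra $\mathcal{E}$ is discriminated by $\mathcal{B}$ iff $\mathcal{B}$ has a trivial subalgebra. Limit algebras. For a finite functional language $\mathtt{L}_0$ and a finite non-empty set of variables $Y$, a diagram-formula in $\mathtt{L}_0$ in variables $Y$ is a conjunction $\varphi$ of formulas of the forms $F(y_1,\dots,y_k)=y_0$, $c=y_0$, $y=y'$ ($F,c\in\mathtt{L}_0$, variables in $Y$) and their negations such that: $\neg(y=y')$ occurs in $\varphi$ for all distinct $y,y'\in Y$; for each function symbol $F\in\mathtt{L}_0$ and all $y_0,\dots,y_k\in Y$ either $F(y_1,\dots,y_k)=y_0$ or its negation occurs in $\varphi$; for each constant $c\in\mathtt{L}_0$ and $y\in Y$ either $c=y$ or its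 negation occurs in $\varphi$. A direct system of formulas in $\mathtt{L}$ is a triple $\Lambda=(I,\varphi_i,\gamma_{ij})$ where $I$ is a directed partial order; for each $i\in I$, $\varphi_i$ is a consistent diagram-formula in a finite sublanguage $\mathtt{L}_i\subseteq\mathtt{L}$ in variables $X_i$; for $i\le j$, $\gamma_{ij}\colon X_i\to X_j$ are maps with $\gamma_{ii}=\mathrm{id}$ and $\gamma_{jk}\gamma_{ij}=\gamma_{ik}$; for $i\le j$, $\mathtt{L}_i\subseteq\mathtt{L}_j$ and every conjunct of $\varphi_i(\gamma_{ij}(X_i))$ is a conjunct of $\varphi_j$; for each constant $c\in\mathtt{L}$ there are $i\in I$, $x\in X_i$ such that $c=x$ is a conjunct of $\varphi_i$; for each function symbol $F\in\mathtt{L}$ of arity $k$, $i\in I$ and $y_1,\dots,y_k\in X_i$ there are $j\ge i$ and $y_0\in X_j$ such that $F(\gamma_{ij}(y_1),\dots,\gamma_{ij}(y_k))=y_0$ is a conjunct of $\varphi_j$. The limit algebra of $\Lambda$ has as universe the direct limit of the sets $X_i$ along the maps $\gamma_{ij}$, with constants and operations determined by the conjuncts $c=x$ and $F(y_1,\dots,y_k)=y_0$ of the $\varphi_i$. An $\mathtt{L}$-algebra is a limit algebra over $\mathcal{B}$ if it is isomorphic to the limit algebra of a direct system of formulas in which every $\varphi_i$ is satisfiable in $\mathcal{B}$. Complete atomic types. For a theory $T$ in $\mathtt{L}$ and a finite set $X$, an atomic type in $T$ in variables $X$ is a set $p$ of atomic formulas and negations of atomic formulas in variables $X$ such that $p\cup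 T$ is consistent (satisfiable, with the variables $X$ interpreted by elements of a model of $T$); it is complete if it is maximal under inclusion. The algebra defined by a complete atomic type $p$ is $\mathcal{T}_{\mathtt{L}}(X)/\theta_{p}$, where $t_1\sim_{\theta_p}t_2$ iff $(t_1=t_2)\in p$ (up to isomorphism). *)

(* Defs.v *)
From Corelib Require Import RelationClasses.
From mathcomp Require Import all_boot all_classical.
Set Implicit Arguments.
Unset Strict Implicit.
Unset Printing Implicit Defensive.
Local Open Scope classical_set_scope.
Local Open Scope quotient_scope.

(* A function symbol of arity 0 is not excluded; it behaves as a constant. *)
Record language := Language {
  cst_sym : Type;
  fun_sym : Type;
  arity : fun_sym -> nat }.

(* The carrier is allowed to be empty, so that the terms in no variables over
   a language without constants still form an algebra.  Wherever nonemptiness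
   of a structure is part of the mathematics, [inhabited] is required. *)
Record algebra (L : language) := Algebra {
  carrier :> Type;
  cinterp : cst_sym L -> carrier;
  finterp : forall F : fun_sym L, ('I_(arity F) -> carrier) -> carrier }.
Arguments cinterp {L} a c.
Arguments finterp {L} a F args.

Inductive term (L : language) (X : Type) : Type :=
| Var of X
| Cst of cst_sym L
| App (F : fun_sym L) of ('I_(arity F) -> term L X).
Arguments Var {L X}.
Arguments Cst {L X}.
Arguments App {L X}.

Definition term_algebra (L : language) (X : Type) : algebra L :=
  @Algebra L (term L X) Cst App.

Fixpoint eval (L : language) (A : algebra L) (X : Type) (a : X -> A)
    (t : term L X) : A :=
  match t with
  | Var x => a x
  | Cst c => cinterp A c
  | App F u => finterp A F (fun i => eval a (u i))
  end.

Definition is_hom (L : language) (A B : algebra L) (h : A -> B) : Prop :=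
  (forall c, h (cinterp A c) = cinterp B c) /\
  (forall F u, h (finterp A F u) = finterp B F (h \o u)).

Definition isomorphic (L : language) (A B : algebra L) : Prop :=
  exists h : A -> B, is_hom h /\ bijective h.

Definition embeds (L : language) (A B : algebra L) : Prop :=
  exists h : A -> B, is_hom h /\ injective h.

Definition subalgebra (L : language) (A : algebra L) (D : set A) : Prop :=
  (forall c, D (cinterp A c)) /\
  (forall F u, (forall i, D (u i)) -> D (finterp A F u)).

Definition finitely_generated (L : language) (A : algebra L) : Prop :=
  exists W : set A, finite_set W /\
    forall D : set A, subalgebra D -> W `<=` D -> D = setT.

Section Quotient.
Variables (T : Type) (R : T -> T -> Prop).
Hypothesis eR : Equivalence R.

Let e : rel {classic T} := fun x y => `[< R x y >].

Let e_refl : reflexive e.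
Proof. by move=> x; apply/asboolP; apply: (@Equivalence_Reflexive _ _ eR). Qed.

Let e_sym : symmetric e.
Proof.
by move=> x y; apply/asboolP/asboolP; apply: (@Equivalence_Symmetric _ _ eR).
Qed.

Let e_trans : transitive e.
Proof.
move=> y x z /asboolP xy /asboolP yz; apply/asboolP.
exact: (@Equivalence_Transitive _ _ eR) xy yz.
Qed.

Definition quot_equiv : equiv_rel {classic T} := EquivRel e e_refl e_sym e_trans.

Definition quot : Type := {eq_quot quot_equiv}.
Definition quot_pi (x : T) : quot := \pi_{eq_quot quot_equiv} (x : {classic T}).
Definition quot_repr (q : quot) : T := repr (q : {eq_quot quot_equiv}).

Lemma quot_reprK (q : quot) : quot_pi (quot_repr q) = q.
Proof. exact: reprK. Qed.

Lemma quot_piP (x y : T) : quot_pi x = quot_pi y <-> R x y.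
Proof.
split=> [/eqmodP /asboolP //|xy].
by apply/eqmodP/asboolP.
Qed.

Lemma quot_reprP (x : T) : R (quot_repr (quot_pi x)) x.
Proof. by apply/quot_piP; exact: quot_reprK. Qed.
End Quotient.

Definition congruence (L : language) (A : algebra L) (R : A -> A -> Prop) :
    Prop :=
  Equivalence R /\
  forall F u v, (forall i, R (u i) (v i)) -> R (finterp A F u) (finterp A F v).

Definition quot_algebra (L : language) (A : algebra L) (R : A -> A -> Prop)
    (cR : congruence R) : algebra L :=
  @Algebra L (quot (proj1 cR))
    (fun c => quot_pi (proj1 cR) (cinterp A c))
    (fun F u => quot_pi (proj1 cR)
                  (finterp A F (fun i => quot_repr (u i)))).

Lemma quot_pi_hom (L : language) (A : algebra L) (R : A -> A -> Prop)
    (cR : congruence R) :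
  @is_hom L A (quot_algebra cR) (quot_pi (proj1 cR)).
Proof.
split=> // F u; apply/quot_piP/(proj2 cR) => i /=.
by apply: (@Equivalence_Symmetric _ _ (proj1 cR)); exact: quot_reprP.
Qed.

Definition power_algebra (L : language) (B : algebra L) (J : Type) : algebra L :=
  @Algebra L (J -> B) (fun c _ => cinterp B c)
    (fun F u j => finterp B F (fun i => u i j)).

Definition filter_eq (L : language) (B : algebra L) (J : Type)
    (U : set_system J) (f g : power_algebra B J) : Prop :=
  U [set j | f j = g j].

Lemma filter_eq_congruence (L : language) (B : algebra L) (J : Type)
    (U : set_system J) : UltraFilter U -> congruence (filter_eq (B := B) U).
Proof.
move=> UU; split; first split; rewrite /filter_eq.
- by move=> f; apply: filterS filterT => j.
- by move=> f g; apply: filterS => j /= ->.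
- by move=> f g h fg gh; apply: filterS (filterI fg gh) => j [/= -> ->].
- move=> F u v uv; apply: filterS (filter_forall _ uv) => j uvj /=.
  by congr finterp; apply/funext.
Qed.

Definition ultrapower (L : language) (B : algebra L) (J : Type)
    (U : set_system J) (hU : UltraFilter U) : algebra L :=
  quot_algebra (filter_eq_congruence B hU).

Definition embeds_in_ultrapower (L : language) (C B : algebra L) : Prop :=
  exists (J : Type) (U : set_system J) (hU : UltraFilter U),
    embeds C (ultrapower B hU).

Inductive qformula (L : language) (X : Type) : Type :=
| QEq of term L X & term L X
| QNot of qformula L X
| QAnd of qformula L X & qformula L X
| QOr of qformula L X & qformula L X.

Fixpoint qsat (L : language) (A : algebra L) (X : Type) (a : X -> A)
    (f : qformula L X) : Prop :=
  match f with
  | QEq t s => eval a t = eval a s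
  | QNot g => ~ qsat a g
  | QAnd g h => qsat a g /\ qsat a h
  | QOr g h => qsat a g \/ qsat a h
  end.

(* A universal (existential) sentence is a quantifier-free formula in finitely
   many variables under a block of universal (existential) quantifiers binding
   all of them. *)
Inductive universal_sentence (L : language) : Type :=
| Forall (n : nat) of qformula L 'I_n.

Inductive existential_sentence (L : language) : Type :=
| Exists (n : nat) of qformula L 'I_n.

Definition usat (L : language) (A : algebra L) (s : universal_sentence L) :
    Prop :=
  let: Forall n f := s in forall a : 'I_n -> A, qsat a f.

Definition esat (L : language) (A : algebra L) (s : existential_sentence L) :
    Prop :=
  let: Exists n f := s in exists a : 'I_n -> A, qsat a f.

Definition Th_forall (L : language) (A : algebra L) :
  set (universal_sentence L) := [set s | usat A s].

Definition Th_exists (L : language) (A : algebra L) :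
  set (existential_sentence L) := [set s | esat A s].

Definition is_model (L : language) (A : algebra L)
    (T : set (universal_sentence L)) : Prop :=
  inhabited A /\ forall s, T s -> usat A s.

Definition Ucl (L : language) (B : algebra L) : algebra L -> Prop :=
  fun C => is_model C (Th_forall B).

Lemma UclP (L : language) (B C : algebra L) : inhabited C ->
  Ucl B C <-> Th_forall B `<=` Th_forall C.
Proof. by move=> C0; split=> [[]//|BC]; split. Qed.

Definition equation (L : language) (n : nat) : Type :=
  (term L 'I_n * term L 'I_n)%type.

Definition eq_holds (L : language) (A : algebra L) (n : nat) (a : 'I_n -> A)
    (e : equation L n) : Prop :=
  eval a e.1 = eval a e.2.

Definition solutions (L : language) (B : algebra L) (n : nat)
    (S : set (equation L n)) : set ('I_n -> B) :=
  [set a | forall e, S e -> eq_holds a e].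
Arguments solutions {L} B {n} S.

Definition algebraic_set (L : language) (B : algebra L) (n : nat)
    (Y : set ('I_n -> B)) : Prop :=
  exists S : set (equation L n), Y = solutions B S.

Definition irreducible (L : language) (B : algebra L) (n : nat)
    (Y : set ('I_n -> B)) : Prop :=
  Y !=set0 /\
  ~ exists (m : nat) (Z : 'I_m -> set ('I_n -> B)),
      (forall i, algebraic_set (Z i) /\ Z i `<` Y) /\
      Y = \bigcup_i Z i.

Definition Rad (L : language) (B : algebra L) (n : nat) (Y : set ('I_n -> B)) :
    set (equation L n) :=
  [set e | forall a, Y a -> eq_holds a e].

Definition theta_Rad (L : language) (B : algebra L) (n : nat)
    (Y : set ('I_n -> B)) (t s : term_algebra L 'I_n) : Prop :=
  Rad Y (t, s).

Lemma theta_Rad_congruence (L : language) (B : algebra L) (n : nat)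
    (Y : set ('I_n -> B)) : congruence (theta_Rad Y).
Proof.
split; first split.
- by move=> t a _.
- by move=> t s ts a Ya; rewrite /eq_holds /= (ts a Ya).
- by move=> t s r ts sr a Ya; rewrite /eq_holds /= (ts a Ya); exact: sr.
- move=> F u v uv a Ya; rewrite /eq_holds /=; congr finterp.
  by apply/funext => i; exact: uv.
Qed.

Definition coordinate_algebra (L : language) (B : algebra L) (n : nat)
    (Y : set ('I_n -> B)) : algebra L :=
  quot_algebra (theta_Rad_congruence Y).

Definition irreducible_coordinate_algebra (L : language) (B C : algebra L) :
    Prop :=
  exists (n : nat) (Y : set ('I_n -> B)),
    [/\ algebraic_set Y, irreducible Y & isomorphic C (coordinate_algebra Y)].

Definition u_omega_compact (L : language) (B : algebra L) : Prop :=
  forall (n : nat) (S : set (equation L n)) (m : nat)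
         (e : 'I_m -> equation L n),
    solutions B S `<=` \bigcup_i solutions B [set e i] ->
    exists S0 : set (equation L n),
      [/\ finite_set S0, S0 `<=` S &
          solutions B S0 `<=` \bigcup_i solutions B [set e i]].

(* For a one-element C the condition says that there is a homomorphism from C
   to B, i.e. that B has a one-element subalgebra. *)
Definition discriminated (L : language) (C B : algebra L) : Prop :=
  forall W : set C, finite_set W -> exists h : C -> B, is_hom h /\ set_inj W h.

Inductive literal (A : Type) : Type := Pos of A | Neg of A.
Arguments Pos {A}.
Arguments Neg {A}.

Definition lit_atom (A : Type) (l : literal A) : A :=
  match l with Pos d | Neg d => d end.

Definition lit_holds (A : Type) (P : A -> Prop) (l : literal A) : Prop :=
  match l with Pos d => P d | Neg d => ~ P d end.

Definition lit_map (A A' : Type) (f : A -> A') (l : literal A) : literal A' :=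
  match l with Pos d => Pos (f d) | Neg d => Neg (f d) end.

Definition atomic_type (L : language) (T : set (universal_sentence L))
    (n : nat) (p : set (literal (equation L n))) : Prop :=
  exists (M : algebra L) (a : 'I_n -> M),
    is_model M T /\ forall l, p l -> lit_holds (eq_holds a) l.

Definition complete_atomic_type (L : language) (T : set (universal_sentence L))
    (n : nat) (p : set (literal (equation L n))) : Prop :=
  atomic_type T p /\
  forall q : set (literal (equation L n)), atomic_type T q -> p `<=` q -> q = p.

Definition theta_type (L : language) (n : nat) (p : set (literal (equation L n)))
    (t s : term_algebra L 'I_n) : Prop :=
  p (Pos (t, s)).

Lemma complete_atomic_typeE (L : language) (T : set (universal_sentence L))
    (n : nat) (p : set (literal (equation L n))) :
  complete_atomic_type T p ->
  exists (M : algebra L) (a : 'I_n -> M),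
    is_model M T /\ p = [set l | lit_holds (eq_holds a) l].
Proof.
move=> [[M [a [MT pa]]] pmax]; exists M, a; split=> //.
by symmetry; apply: pmax => //; exists M, a; split.
Qed.

Lemma theta_type_congruence (L : language) (T : set (universal_sentence L))
    (n : nat) (p : set (literal (equation L n))) :
  complete_atomic_type T p -> congruence (theta_type p).
Proof.
move=> /complete_atomic_typeE[M [a [_ ->]]]; split; first split.
- by move=> t.
- by move=> t s ts; rewrite /theta_type /eq_holds /= ts.
- by move=> t s r; rewrite /theta_type /eq_holds /= => -> ->.
- move=> F u v uv; rewrite /theta_type /eq_holds /=; congr finterp.
  by apply/funext => i; exact: uv.
Qed.

Definition type_algebra (L : language) (T : set (universal_sentence L))
    (n : nat) (p : set (literal (equation L n)))
    (hp : complete_atomic_type T p) : algebra L :=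
  quot_algebra (theta_type_congruence hp).

Definition defined_by_type (L : language) (T : set (universal_sentence L))
    (C : algebra L) : Prop :=
  exists (n : nat) (p : set (literal (equation L n)))
         (hp : complete_atomic_type T p), isomorphic C (type_algebra hp).

Inductive diagram_atom (L : language) (X : Type) : Type :=
| DFun (F : fun_sym L) of ('I_(arity F) -> X) & X
| DCst of cst_sym L & X
| DEq of X & X.
Arguments DFun {L X}.
Arguments DCst {L X}.
Arguments DEq {L X}.

Definition diagram_atom_holds (L : language) (X : Type) (A : algebra L)
    (a : X -> A) (d : diagram_atom L X) : Prop :=
  match d with
  | DFun F y y0 => finterp A F (a \o y) = a y0
  | DCst c y0 => cinterp A c = a y0
  | DEq y y' => a y = a y'
  end.

Definition diagram_atom_map (L : language) (X X' : Type) (g : X -> X')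
    (d : diagram_atom L X) : diagram_atom L X' :=
  match d with
  | DFun F y y0 => DFun F (g \o y) (g y0)
  | DCst c y0 => DCst c (g y0)
  | DEq y y' => DEq (g y) (g y')
  end.

Definition in_sublanguage (L : language) (X : Type) (Lc : set (cst_sym L))
    (Lf : set (fun_sym L)) (d : diagram_atom L X) : Prop :=
  match d with
  | DFun F _ _ => Lf F
  | DCst c _ => Lc c
  | DEq _ _ => True
  end.

(* A conjunction is represented by its finite set of conjuncts, and a
   sublanguage of L by its sets Lc of constants and Lf of function symbols. *)
Definition diagram_formula (L : language) (Lc : set (cst_sym L)) (Lf : set (fun_sym L))
    (X : finType) (f : set (literal (diagram_atom L X))) : Prop :=
  [/\ finite_set f,
      forall l, f l -> in_sublanguage Lc Lf (lit_atom l),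
      forall y y' : X, y <> y' -> f (Neg (DEq y y')),
      forall F (y : 'I_(arity F) -> X) (y0 : X), Lf F ->
        f (Pos (DFun F y y0)) \/ f (Neg (DFun F y y0)) &
      forall c (y : X), Lc c -> f (Pos (DCst c y)) \/ f (Neg (DCst c y))].

Definition satisfiable_in (L : language) (X : Type) (A : algebra L)
    (f : set (literal (diagram_atom L X))) : Prop :=
  exists a : X -> A, forall l, f l -> lit_holds (diagram_atom_holds a) l.

(* For a formula in a sublanguage of L this does not depend on the language:
   a nonempty algebra over the sublanguage expands to an L-algebra. *)
Definition consistent (L : language) (X : Type)
    (f : set (literal (diagram_atom L X))) : Prop :=
  exists A : algebra L, inhabited A /\ satisfiable_in A f.

Record direct_system (L : language) := DirectSystem {
  ds_index : Type;
  ds_le : ds_index -> ds_index -> Prop;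
  ds_inhabited : inhabited ds_index;
  ds_refl : forall i, ds_le i i;
  ds_antisym : forall i j, ds_le i j -> ds_le j i -> i = j;
  ds_trans : forall i j k, ds_le i j -> ds_le j k -> ds_le i k;
  ds_directed : forall i j, exists k, ds_le i k /\ ds_le j k;
  ds_Lc : ds_index -> set (cst_sym L);
  ds_Lf : ds_index -> set (fun_sym L);
  ds_Lc_finite : forall i, finite_set (ds_Lc i);
  ds_Lf_finite : forall i, finite_set (ds_Lf i);
  ds_var : ds_index -> finType;
  ds_var_gt0 : forall i, 0 < #|ds_var i|;
  ds_formula : forall i, set (literal (diagram_atom L (ds_var i)));
  ds_diagram : forall i, diagram_formula (ds_Lc i) (ds_Lf i) (@ds_formula i);
  ds_consistent : forall i, consistent (@ds_formula i);
  ds_map : forall i j, ds_le i j -> ds_var i -> ds_var j;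
  ds_map_id : forall i (h : ds_le i i) x, ds_map h x = x;
  ds_map_comp : forall i j k (hij : ds_le i j) (hjk : ds_le j k)
    (hik : ds_le i k) x, ds_map hjk (ds_map hij x) = ds_map hik x;
  ds_Lc_sub : forall i j, ds_le i j -> ds_Lc i `<=` ds_Lc j;
  ds_Lf_sub : forall i j, ds_le i j -> ds_Lf i `<=` ds_Lf j;
  ds_formula_sub : forall i j (h : ds_le i j) l, @ds_formula i l ->
    @ds_formula j (lit_map (diagram_atom_map (ds_map h)) l);
  ds_cst_ex : forall c : cst_sym L, exists i (x : ds_var i),
    @ds_formula i (Pos (DCst c x));
  ds_fun_ex : forall (F : fun_sym L) i (y : 'I_(arity F) -> ds_var i),
    exists j (h : ds_le i j) (y0 : ds_var j),
      @ds_formula j (Pos (DFun F (ds_map h \o y) y0)) }.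

Section Limit.
Variables (L : language) (D : direct_system L).
Implicit Types p q : {i : ds_index D & ds_var i}.

Definition dlim_eq p q : Prop :=
  exists k (hp : ds_le (tag p) k) (hq : ds_le (tag q) k),
    ds_map hp (tagged p) = ds_map hq (tagged q).

Lemma dlim_eq_equiv : Equivalence dlim_eq.
Proof.
split=> [[i x]|p q [k [hp [hq e]]]|p q r [k [hp [hq e]]] [l [hq' [hr e']]]].
- by exists i, (ds_refl i), (ds_refl i).
- by exists k, hq, hp.
- have [m [km lm]] := ds_directed k l.
  exists m, (ds_trans hp km), (ds_trans hr lm).
  rewrite -(ds_map_comp hp km) e -(ds_map_comp hr lm) -e'.
  by rewrite !(ds_map_comp _ _ (ds_trans hq km)).
Qed.

Definition dlim : Type := quot dlim_eq_equiv.
Definition dlim_in i (x : ds_var i) : dlim :=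
  quot_pi dlim_eq_equiv (Tagged (fun i => ds_var (d := D) i) x).

Lemma dlim_inP i j (x : ds_var i) (y : ds_var j) :
  dlim_in x = dlim_in y <->
  exists k (hi : ds_le i k) (hj : ds_le j k), ds_map hi x = ds_map hj y.
Proof. exact: quot_piP. Qed.

Lemma dlim_in_map i j (h : ds_le (d := D) i j) (x : ds_var i) :
  dlim_in (ds_map h x) = dlim_in x.
Proof.
by apply/dlim_inP; exists j, (ds_refl j), h; rewrite ds_map_id.
Qed.

Lemma dlim_in_surj (z : dlim) : exists i (x : ds_var i), z = dlim_in x.
Proof.
exists (tag (quot_repr z)), (tagged (quot_repr z)).
by rewrite /dlim_in -[LHS]quot_reprK; case: (quot_repr z).
Qed.

Lemma dlim_in_bound n (u : 'I_n -> dlim) :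
  exists i (y : 'I_n -> ds_var i), forall l, u l = dlim_in (y l).
Proof.
have [i ui] : exists i, forall l, exists x : ds_var (d := D) i, u l = dlim_in x.
  elim: n u => [|n IHn] u; first by case: (ds_inhabited D) => i; exists i => -[].
  have [i ui] := IHn (fun l => u (lift ord0 l)).
  have [j [x ux]] := dlim_in_surj (u ord0).
  have [k [ik jk]] := ds_directed i j.
  exists k => l; case: (unliftP ord0 l) => [l' ->|->].
    by have [y ->] := ui l'; exists (ds_map ik y); rewrite dlim_in_map.
  by exists (ds_map jk x); rewrite dlim_in_map.
by have [y uy] := choice ui; exists i, y.
Qed.

Lemma dlim_in_common i j n (x : 'I_n -> ds_var (d := D) i) (y : 'I_n -> ds_var j) :
  (forall l, dlim_in (x l) = dlim_in (y l)) ->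
  exists k (hi : ds_le i k) (hj : ds_le j k),
    ds_map hi \o x = ds_map hj \o y.
Proof.
move=> xy.
suff [k [hi [hj e]]] : exists k (hi : ds_le i k) (hj : ds_le j k),
    forall l, ds_map hi (x l) = ds_map hj (y l).
  by exists k, hi, hj; apply/funext.
elim: n x y xy => [|n IHn] x y xy.
  by have [k [hi hj]] := ds_directed i j; exists k, hi, hj => -[].
have [k [hi [hj e]]] :=
  IHn (x \o lift ord0) (y \o lift ord0) (fun l => xy (lift ord0 l)).
have /dlim_inP[k' [hi' [hj' e']]] := xy ord0.
have [m [km k'm]] := ds_directed k k'.
exists m, (ds_trans hi km), (ds_trans hj km) => l.
case: (unliftP ord0 l) => [l' ->|->].
  by rewrite -(ds_map_comp hi km) -(ds_map_comp hj km) [in LHS]e.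
rewrite -(ds_map_comp hi' k'm (ds_trans hi km)) e'.
by rewrite (ds_map_comp hj' k'm (ds_trans hj km)).
Qed.

Lemma ds_formula_eq i (y y' : ds_var (d := D) i) :
  (forall (A : algebra L) (a : ds_var i -> A),
     (forall l, @ds_formula _ D i l -> lit_holds (diagram_atom_holds a) l) ->
     a y = a y') -> y = y'.
Proof.
move=> H; apply: contrapT => yy'.
have [A [_ [a Aa]]] := ds_consistent (d := D) i.
have [_ _ /(_ _ _ yy') /Aa + _ _] := ds_diagram (d := D) i.
by apply; exact: H.
Qed.

Definition limit_cst_graph (c : cst_sym L) (z : dlim) : Prop :=
  exists i (x : ds_var i), ds_formula (Pos (DCst c x)) /\ z = dlim_in x.

Definition limit_fun_graph (F : fun_sym L) (u : 'I_(arity F) -> dlim) (z : dlim) :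
    Prop :=
  exists i (y : 'I_(arity F) -> ds_var i) (y0 : ds_var i),
    [/\ ds_formula (Pos (DFun F y y0)), forall l, u l = dlim_in (y l) &
        z = dlim_in y0].

Lemma limit_cst_total c : exists z, limit_cst_graph c z.
Proof.
by have [i [x cx]] := ds_cst_ex D c; exists (dlim_in x), i, x.
Qed.

Lemma limit_cst_unique c z z' :
  limit_cst_graph c z -> limit_cst_graph c z' -> z = z'.
Proof.
move=> [i [x [cx ->]]] [j [y [cy ->]]].
have [k [ik jk]] := ds_directed i j.
rewrite -(dlim_in_map ik) -(dlim_in_map jk); congr dlim_in.
apply: ds_formula_eq => A a Aa.
have /Aa/= <- := ds_formula_sub ik cx.
by have /Aa/= <- := ds_formula_sub jk cy.
Qed.

Lemma limit_fun_total F u : exists z, @limit_fun_graph F u z.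
Proof.
have [i [y uy]] := dlim_in_bound u.
have [j [h [y0 Fy]]] := ds_fun_ex y.
exists (dlim_in y0), j, (ds_map h \o y), y0; split=> // l.
by rewrite dlim_in_map.
Qed.

Lemma limit_fun_unique F u z z' :
  @limit_fun_graph F u z -> limit_fun_graph u z' -> z = z'.
Proof.
move=> [i [x [x0 [Fx ux ->]]]] [j [y [y0 [Fy uy ->]]]].
have [|k [ik [jk e]]] := @dlim_in_common i j _ x y.
  by move=> l; rewrite -ux.
rewrite -(dlim_in_map ik) -(dlim_in_map jk); congr dlim_in.
apply: ds_formula_eq => A a Aa.
have /Aa/= <- := ds_formula_sub ik Fx.
by have /Aa/= <- := ds_formula_sub jk Fy; rewrite e.
Qed.

Definition limit_algebra : algebra L :=
  @Algebra L dlim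
    (fun c => projT1 (cid (limit_cst_total c)))
    (fun F u => projT1 (cid (@limit_fun_total F u))).

Lemma limit_cstE c z : cinterp limit_algebra c = z <-> limit_cst_graph c z.
Proof.
rewrite /=; case: cid => w cw /=; split=> [<- //|].
exact: limit_cst_unique.
Qed.

Lemma limit_funE F u z : finterp limit_algebra F u = z <-> limit_fun_graph u z.
Proof.
rewrite /=; case: cid => w cw /=; split=> [<- //|].
exact: limit_fun_unique.
Qed.
End Limit.

Definition limit_algebra_over (L : language) (B C : algebra L) : Prop :=
  exists D : direct_system L,
    (forall i, satisfiable_in B (@ds_formula L D i)) /\
    isomorphic C (limit_algebra D).

(* Main.v *)
From Corelib Require Import RelationClasses.
Require Import Defs.
From mathcomp Require Import all_boot finmap all_classical.
Set Implicit Arguments.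
Unset Strict Implicit.
Unset Printing Implicit Defensive.
Local Open Scope classical_set_scope.

(* Conditions 1, 2, 3, 5 and 6 say that finitely many equations and inequations true at
   the generators g of C can be realized in B.  When the realization can be
   required to satisfy every equation true at g and to avoid finitely many false
   ones, C is discriminated by B, and equivalently the solution set over B of
   the equations true at g is irreducible with C as coordinate algebra; the
   passage from finitely many equations to all of them is exactly
   u_omega-compactness.  Conversely, if u_omega-compactness fails for S and
   e_1, ..., e_m, then an ultrapower of B contains a solution of S satisfying no
   e_k, and the subalgebra that it generates is not discriminated by B. *)

Lemma finite_set_range (T : Type) (A : set T) :
  finite_set A -> exists (n : nat) (f : 'I_n -> T), A = range f.
Proof.
move=> /(@finite_seqP {classic T})[s As].
exists (size s), (fun i => tnth (in_tuple s) i); rewrite As.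
apply/seteqP; split=> [x /= xs|x [i _ <-]]; last exact: mem_tnth.
by have /tnthP[i ->] : x \in in_tuple s by []; exists i.
Qed.

(** * Generators, homomorphisms and quotients of term algebras *)

Section Homomorphisms.
Variable L : language.
Implicit Types A B C : algebra L.

Lemma hom_eval A B (h : A -> B) (X : Type) (a : X -> A) (t : term L X) :
  is_hom h -> h (eval a t) = eval (h \o a) t.
Proof.
move=> [hc hF]; elim: t => //= F u IHu; rewrite hF; congr finterp.
exact/funext.
Qed.

Lemma isomorphic_sym A B : isomorphic A B -> isomorphic B A.
Proof.
move=> [h [[hc hF] [k hK kK]]]; exists k; split; last by exists h.
split=> [c|F u]; first by rewrite -hc hK.
rewrite -[RHS]hK hF; congr (k (finterp _ _ _)).
by apply/funext => i /=; rewrite kK.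
Qed.

Lemma qsat_embedding A B (h : A -> B) (X : Type) (a : X -> A)
    (f : qformula L X) :
  is_hom h -> injective h -> qsat (h \o a) f <-> qsat a f.
Proof.
move=> hh hinj; elim: f => /= [t s|f IHf|f IHf g IHg|f IHf g IHg].
- by rewrite -!hom_eval//; split=> [/hinj|->].
- by rewrite IHf.
- by rewrite IHf IHg.
- by rewrite IHf IHg.
Qed.

(** The witness [W] consists of the values of the terms occurring in [f]: the truth of [f] depends
    only on equalities between them, which [h] preserves and reflects. *)
Lemma qsat_local A (X : Type) (a : X -> A) (f : qformula L X) :
  exists W : set A, finite_set W /\
    forall B (h : A -> B), is_hom h -> set_inj W h ->
      qsat (h \o a) f <-> qsat a f.
Proof.
elim: f => /= [t s|f [W [Wfin Wf]]|f [W [Wfin Wf]] g [V [Vfin Vg]]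
             |f [W [Wfin Wf]] g [V [Vfin Vg]]].
- exists [set eval a t; eval a s]; split=> [|B h hh hinj].
    by rewrite finite_setU; split; exact: finite_set1.
  rewrite -!hom_eval//; split=> [|->//].
  by apply: hinj; rewrite inE /=; [left|right].
- by exists W; split=> // B h hh hinj; rewrite Wf.
- exists (W `|` V); split=> [|B h hh hinj]; first by rewrite finite_setU.
  by rewrite Wf ?Vg// => x y /set_mem xV /set_mem yV; apply: hinj; apply/mem_set;
     [right|right|left|left].
- exists (W `|` V); split=> [|B h hh hinj]; first by rewrite finite_setU.
  by rewrite Wf ?Vg// => x y /set_mem xV /set_mem yV; apply: hinj; apply/mem_set;
     [right|right|left|left].
Qed.

Definition generates A (n : nat) (g : 'I_n -> A) : Prop :=
  forall x, exists t, eval g t = x.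

Lemma finitely_generatedP A :
  finitely_generated A <-> exists (n : nat) (g : 'I_n -> A), generates g.
Proof.
split=> [[W [/finite_set_range[n [g ->]] Wgen]]|[n [g ggen]]].
  exists n, g => x.
  suff : setT `<=` [set y | exists t, eval g t = y] by apply.
  rewrite (Wgen [set y | exists t, eval g t = y])// => [|_ [i _ <-]]; last by exists (Var i).
  split=> [c|F u /choice[t tu]]; first by exists (Cst c).
  by exists (App F t) => /=; congr finterp; apply/funext.
exists (range g); split; first exact/finite_image/finite_finset.
move=> D [Dc DF] gD; apply/seteqP; split=> // x _.
have [t <-] := ggen x; elim: t => [i|c|F u IHu] //=; last exact: DF.
by apply: gD; exists i.
Qed.

Lemma generates_term A (n : nat) (g : 'I_n -> A) :
  inhabited A -> generates g -> inhabited (term L 'I_n).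
Proof. by move=> [x] /(_ x)[t _]. Qed.

(** Each element is sent to the value at [b] of some term naming it; the inclusion of relations
    makes the choice of the term irrelevant. *)
Lemma hom_of_generators A B (n : nat) (g : 'I_n -> A) (b : 'I_n -> B) :
  generates g -> (forall t s, eval g t = eval g s -> eval b t = eval b s) ->
  exists h : A -> B, is_hom h /\ forall t, h (eval g t) = eval b t.
Proof.
move=> /choice[tau gtau] gb; exists (eval b \o tau).
split=> [|t]; last by apply: gb; rewrite gtau.
split=> [c|F u] /=; first by apply: (gb _ (Cst c)); rewrite gtau.
by apply: (gb _ (App F (tau \o u))); rewrite gtau; congr finterp;
   apply/funext => i; exact/esym/gtau.
Qed.

(** Coordinate algebras and algebras of types are both quotients of term algebras. An isomorphism
    with either is traded here for a tuple of generators with prescribed relations. *)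
Lemma isomorphic_quotP C (n : nat)
    (R : term_algebra L 'I_n -> term_algebra L 'I_n -> Prop)
    (cR : congruence R) :
  isomorphic C (quot_algebra cR) <->
  exists g : 'I_n -> C, generates g /\ forall t s, eval g t = eval g s <-> R t s.
Proof.
pose p : term_algebra L 'I_n -> quot_algebra cR := quot_pi (proj1 cR).
have evalp t : eval (p \o Var) t = p t.
  rewrite -hom_eval; last exact: quot_pi_hom.
  by congr p; elim: t => //= F u IHu; congr App; apply/funext.
have pgen : generates (p \o Var).
  by move=> q; exists (quot_repr q); rewrite evalp; exact: quot_reprK.
split=> [/isomorphic_sym[h [hh hbij]]|[g [ggen gR]]].
  exists (h \o (p \o Var)); split=> [x|t s].
    have [k _ kK] := hbij; have [t tx] := pgen (k x).
    by exists t; rewrite -hom_eval// tx kK.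
  rewrite -!(hom_eval (p \o Var) _ hh) !evalp -(quot_piP (proj1 cR)).
  by split=> [/(bij_inj hbij)|pts] //; congr h.
have [|h [hh hE]] := hom_of_generators ggen (b := p \o Var).
  by move=> t s; rewrite !evalp gR => ?; exact/quot_piP.
have [|k [kh kE]] := hom_of_generators pgen (b := g).
  by move=> t s; rewrite !evalp gR => ?; exact/(quot_piP (proj1 cR)).
exists h; split=> //; exists k => x.
- by have [t <-] := ggen x; rewrite hE kE.
- by have [t <-] := pgen x; rewrite kE hE.
Qed.

End Homomorphisms.

(** * Universal and existential theories *)

Section Theories.
Variable L : language.
Implicit Types B C : algebra L.

Lemma Th_forall_existsP B C :
  Th_forall B `<=` Th_forall C <-> Th_exists C `<=` Th_exists B.
Proof.
split=> [BC [n f] [a af]|CB [n f] Bf a].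
  apply: contrapT => nBf.
  by apply: (BC (Forall (QNot f)) _ a) => // b bf; apply: nBf; exists b.
apply: contrapT => naf.
by have [|b] := CB (Exists (QNot f)); [exists a|apply; exact: Bf].
Qed.

Lemma embeds_Th_forall B C : embeds C B -> Th_forall B `<=` Th_forall C.
Proof.
move=> [h [hh hinj]] [n f] Bf a; apply/(qsat_embedding _ _ hh hinj); exact: Bf.
Qed.

Lemma discriminated_Th_exists B C :
  discriminated C B -> Th_exists C `<=` Th_exists B.
Proof.
move=> CB [n f] [a af]; have [W [Wfin Wf]] := qsat_local a f.
by have [h [hh hinj]] := CB W Wfin; exists (h \o a); apply/Wf.
Qed.

(** The term [t0] supplies the empty conjunction [t0 = t0]: formulas have no constant for truth, and
    [term L X] may be empty. *)
Lemma finite_conjunction (X : Type) (t0 : term L X) (F : set (qformula L X)) :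
  finite_set F ->
  exists f, forall B (a : X -> B), qsat a f <-> forall g, F g -> qsat a g.
Proof.
move=> /(@finite_seqP {classic qformula L X})[s ->]; elim: s => [|g s [f fs]].
  by exists (QEq t0 t0) => B a /=; split.
exists (QAnd g f) => B a /=; rewrite fs; split=> [[ag as_] k|as_].
  by rewrite inE => /orP[/eqP->|/as_].
by split=> [|k ks]; apply: as_; rewrite inE ?eqxx ?ks ?orbT.
Qed.

End Theories.

(** * The theorem of Los and compactness through ultrapowers *)

Section Ultrapowers.
Variables (L : language) (B : algebra L).

Section Los.
Variables (J : Type) (U : set_system J) (hU : UltraFilter U).
Variables (X : Type) (a : X -> J -> B).

Let a' : X -> ultrapower B hU := fun x => quot_pi _ (a x).

Lemma eval_ultrapower t s :
  eval a' t = eval a' s <-> U [set j | eval (a^~ j) t = eval (a^~ j) s].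
Proof.
have evalE r : eval a' r = quot_pi (proj1 (filter_eq_congruence B hU))
    (fun j => eval (a^~ j) r).
  rewrite -(hom_eval (A := power_algebra B J) a); last exact: quot_pi_hom.
  congr quot_pi; elim: r => //= F u IHu; apply/funext => j; congr finterp.
  by apply/funext => i; rewrite IHu.
by rewrite !evalE; exact: quot_piP.
Qed.

Lemma qsat_ultrapower f : qsat a' f <-> U [set j | qsat (a^~ j) f].
Proof.
have PU : ProperFilter U := ultra_proper.
elim: f => [t s|f IHf|f IHf g IHg|f IHf g IHg].
- exact: eval_ultrapower.
(* Negation, like disjunction below, uses that an ultrafilter contains each set or its
   complement. *)
- rewrite /= IHf; split=> [nUf|Unf Uf].
    by have [//|] := in_ultra_setVsetC [set j | qsat (a^~ j) f] hU.
  by have [j []] := filter_ex (filterI Unf Uf).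
- rewrite /= IHf IHg; split=> [[Uf Ug]|Ufg]; first exact: filterI.
  by split; apply: filterS Ufg => j [].
- rewrite /= IHf IHg; split=> [[|]|Ufg].
  + by apply: filterS => j; left.
  + by apply: filterS => j; right.
  apply: contrapT => /not_orP[nf ng].
  have [//|Uf] := in_ultra_setVsetC [set j | qsat (a^~ j) f] hU.
  have [//|Ug] := in_ultra_setVsetC [set j | qsat (a^~ j) g] hU.
  by have [j [[? ?] []]] := filter_ex (filterI (filterI Uf Ug) Ufg).
Qed.

End Los.

Lemma ultrapower_Th_exists J (U : set_system J) (hU : UltraFilter U) :
  Th_exists (ultrapower B hU) `<=` Th_exists B.
Proof.
move=> [n f] [a af].
have PU : ProperFilter U := ultra_proper.
have aE : a = fun x => quot_pi (proj1 (filter_eq_congruence B hU)) (quot_repr (a x)).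
  by apply/funext => x; rewrite quot_reprK.
move: af; rewrite aE => /qsat_ultrapower/filter_ex[j jf].
by exists (fun x => quot_repr (a x) j).
Qed.

(** The indices are the finite subsets of [Phi], each with a realization in [B]. The sets of indices
    above a given one generate a proper filter; an ultrafilter extending it contains, for each [f]
    in [Phi], the set of indices above [[set f]], at all of which [f] is realized. *)
Lemma finitely_satisfiable (X : Type) (Phi : set (qformula L X)) :
  (forall F, finite_set F -> F `<=` Phi ->
     exists b : X -> B, forall f, F f -> qsat b f) ->
  exists (J : Type) (U : set_system J) (hU : UltraFilter U)
         (a : X -> ultrapower B hU), forall f, Phi f -> qsat a f.
Proof.
move=> finsat.
pose J := {F : set (qformula L X) | finite_set F /\ F `<=` Phi}.
have /choice[b bP] : forall F : J, exists b : X -> B, forall f, sval F f -> qsat b f.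
  by move=> [F [Ffin FPhi]] /=; exact: finsat.
pose U0 : set_system J := [set P | exists F : J, forall G : J,
  sval F `<=` sval G -> P G].
have PU0 : ProperFilter U0.
  split; first by move=> [F] /(_ F); apply.
  split.
  - have h0 : finite_set (@set0 (qformula L X)) /\ set0 `<=` Phi.
      by split; [exact: finite_set0|].
    by exists (exist _ set0 h0).
  - move=> P Q [[F [Ffin FPhi]] FP] [[G [Gfin GPhi]] GQ] /=.
    have hFG : finite_set (F `|` G) /\ F `|` G `<=` Phi.
      by split; [rewrite finite_setU|rewrite subUset].
    exists (exist _ (F `|` G) hFG) => K /= FGK.
    by split; [apply: FP|apply: GQ] => f Ff; apply: FGK; [left|right].
  - by move=> P Q PQ [F FP]; exists F => G /FP/PQ.
have [U [hU U0U]] := ultraFilterLemma PU0.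
exists J, U, hU, (fun x => quot_pi _ (b^~ x)) => f Phif.
apply/qsat_ultrapower/U0U.
have h1 : finite_set [set f] /\ [set f] `<=` Phi.
  by split; [exact: finite_set1|move=> _ ->].
exists (exist _ [set f] h1) => F /= fF; apply: bP; exact: fF.
Qed.

(** An ultrapower realizes all quantifier-free formulas true at [g] at once; the equations among
    them yield a homomorphism and the inequations its injectivity. *)
Lemma Th_exists_embeds_in_ultrapower (C : algebra L) : inhabited C -> finitely_generated C ->
  Th_exists C `<=` Th_exists B -> embeds_in_ultrapower C B.
Proof.
move=> C0 /finitely_generatedP[n [g ggen]] CB.
have [t0] := generates_term C0 ggen.
have [|J [U [hU [a aP]]]] := @finitely_satisfiable 'I_n [set f | qsat g f].
  move=> F Ffin Fg; have [f fF] := finite_conjunction t0 Ffin.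
  have [|b bf] := CB (Exists f); first by exists g; apply/fF.
  by exists b; apply/fF.
exists J, U, hU.
have [|h [hh hE]] := hom_of_generators ggen (b := a).
  by move=> t s ts; exact: (aP (QEq t s)).
exists h; split=> // x y; have [t <-] := ggen x; have [s <-] := ggen y.
rewrite !hE => ats; apply: contrapT => nts.
exact: (aP (QNot (QEq t s))).
Qed.

End Ultrapowers.

(** * Discrimination, compactness and irreducible algebraic sets *)

Section Separation.
Variable L : language.
Implicit Types B C : algebra L.

(** Discrimination expressed through generators: [b] is to be the image of [g] under a homomorphism,
    and [E] lists the pairs of elements to be kept apart. *)
Definition separated B C (n : nat) (g : 'I_n -> C) : Prop :=
  forall E : set (equation L n), finite_set E ->
    (forall e, E e -> ~ eq_holds g e) ->
    exists b : 'I_n -> B, (forall e, eq_holds g e -> eq_holds b e) /\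
      forall e, E e -> ~ eq_holds b e.

Lemma discriminatedP B C (n : nat) (g : 'I_n -> C) : generates g ->
  discriminated C B <-> separated B g.
Proof.
move=> ggen; split=> [CB E Efin Eg|gB W Wfin].
  pose W := (fun e : equation L n => eval g e.1) @` E `|`
            (fun e : equation L n => eval g e.2) @` E.
  have Wfin : finite_set W by rewrite finite_setU; split; exact: finite_image.
  have [h [hh hinj]] := CB W Wfin; exists (h \o g).
  split=> [e|e Ee]; rewrite /eq_holds -!hom_eval//; first by move=> ->.
  move=> hE.
  by apply: (Eg e Ee); apply: hinj => //; apply/mem_set;
     [left; exists e|right; exists e].
have [tau gtau] := choice ggen.
(* [tau] names each element by a term; [E] equates the names of distinct elements of [W]. *)
pose E : set (equation L n) := [set (tau x, tau y) | x in W & y in W] `&`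
  [set e | ~ eq_holds g e].
have [|e [_]//|b [gb Eb]] := gB E.
  apply: (sub_finite_set (@subIsetl _ _ _)).
  exact: finite_image2.
have [t s ts|h [hh hE]] := hom_of_generators ggen (b := b).
  exact: (gb (t, s)).
exists h; split=> // x y /set_mem Wx /set_mem Wy.
rewrite -(gtau x) -(gtau y) !hE => bxy; apply: contrapT => nxy.
by apply: (Eb (tau x, tau y)) => //; split=> //; exists x => //; exists y.
Qed.

(** If no point over [B] separates [E], the solutions of the equations true at [g] are covered by
    those of the members of [E]. Compactness leaves finitely many equations, which together with the
    negations of [E] give an existential sentence true in [C] and false in [B]. *)
Lemma u_omega_compact_discriminated B C : u_omega_compact B ->
  inhabited C -> finitely_generated C ->
  Th_exists C `<=` Th_exists B -> discriminated C B.
Proof.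
move=> Bcomp C0 /finitely_generatedP[n [g ggen]] CB.
have [t0] := generates_term C0 ggen.
apply/(discriminatedP _ ggen) => E Efin Eg.
apply: contrapT => nsep.
have [m [e Ee]] := finite_set_range Efin.
have [|S0 [S0fin S0g S0E]] := Bcomp n [set e | eq_holds g e] m e.
  move=> b bS; apply: contrapT => be; apply: nsep; exists b; split=> // e'.
  by rewrite Ee => -[i _ <-] bi; apply: be; exists i => // _ ->.
pose F := (fun e => QEq e.1 e.2) @` S0 `|` (fun e => QNot (QEq e.1 e.2)) @` E.
have Ffin : finite_set F by rewrite finite_setU; split; exact: finite_image.
have [f fF] := finite_conjunction t0 Ffin.
have [|b /fF bF] := CB (Exists f).
  by exists g; apply/fF => _ [[e' e'S <-]|[e' e'E <-]]; [exact: S0g|exact: Eg].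
have [|i _ bi] := S0E b.
  by move=> e' e'S; apply: (bF (QEq e'.1 e'.2)); left; exists e'.
apply: (bF (QNot (QEq (e i).1 (e i).2))); last exact: bi.
by right; exists (e i) => //; rewrite Ee; exists i.
Qed.

Lemma discriminated_irreducibleP B C : finitely_generated C ->
  discriminated C B <-> irreducible_coordinate_algebra B C.
Proof.
move=> /finitely_generatedP[n [g ggen]]; split.
  move=> /(discriminatedP _ ggen) gsep.
  pose S := [set e : equation L n | eq_holds g e].
  have SRad : Rad (solutions B S) = S.
    apply/seteqP; split=> [e eR|e eS a]; last exact.
    apply: contrapT => nge.
    have [|_ ->//|b [gb /(_ e erefl)]] := gsep [set e]; first exact: finite_set1.
    by apply; apply: eR.
  exists n, (solutions B S); split; first by exists S.
  - split.
      have [|//|b [gb _]] := gsep set0; first exact: finite_set0.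
      by exists b.
    move=> [m [Z [Zalg YZ]]].
    (* Properness of [Z i] gives an equation valid on [Z i] but false at [g]. A point satisfying the
       relations of [g] and none of these equations lies in [solutions B S] and in no [Z i]. *)
    have /choice[e eP] (i : 'I_m) : exists e : equation L n,
        Rad (Z i) e /\ ~ eq_holds g e.
      have [[Si ZSi] [_ nYZ]] := Zalg i.
      apply: contrapT => /forallNP nex; apply: nYZ => a aS; rewrite ZSi => e eSi.
      apply: aS; apply: contrapT => nge; apply: (nex e); split=> //.
      by rewrite ZSi => b; exact.
    have [|_ [i _ <-]|b [gb be]] := gsep (range e); last 1 first.
    + have : solutions B S b by [].
      rewrite YZ => -[i _ bZ]; apply: (be (e i)); first by exists i.
      exact: (proj1 (eP i)).
    + exact/finite_image/finite_finset.
    + exact: (proj2 (eP i)).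
  - apply/isomorphic_quotP; exists g; split=> // t s.
    by rewrite /theta_Rad SRad.
move=> [k [Y [[S YS] [Y0 Yirr] /isomorphic_quotP[g' [g'gen g'Y]]]]].
apply/(discriminatedP _ g'gen) => E Efin Eg'.
apply: contrapT => nsep; apply: Yirr.
have [m [e Ee]] := finite_set_range Efin.
(* Since [E] is not separated, its equations cut out algebraic subsets covering [Y]; these are
   proper because an equation false at [g'] is outside the radical of [Y]. *)
exists m, (fun i => Y `&` solutions B [set e i]); split=> [i|].
  split; first exists (S `|` [set e i]).
    apply/seteqP; split=> [a [aY ai] e' [e'S|/ai//]|a aSi].
      by move: aY; rewrite YS; apply.
    by split; [rewrite YS|] => e' e'S; apply: aSi; [left|right].
  split; first by move=> a [].
  move=> Ysub; have : ~ eq_holds g' (e i) by apply: Eg'; rewrite Ee; exists i.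
  apply; apply/g'Y => a /Ysub[_]; apply; case: (e i) => //.
apply/seteqP; split=> [a aY|a [i _ []]//].
apply: contrapT => na; apply: nsep; exists a; split=> [[t s] /g'Y|e'].
  exact.
by rewrite Ee => -[i _ <-] ai; apply: na; exists i => //; split=> // _ ->.
Qed.

End Separation.

(** * Complete atomic types *)

Section AtomicTypes.
Variable L : language.
Implicit Types B C : algebra L.

(** The literals true at the generators form a type realized in [C] itself; it contains each
    equation or its negation, hence is maximal. *)
Lemma Th_forall_defined_by_type B C : inhabited C -> finitely_generated C ->
  Th_forall B `<=` Th_forall C -> defined_by_type (Th_forall B) C.
Proof.
move=> C0 /finitely_generatedP[n [g ggen]] BC.
pose p := [set l : literal (equation L n) | lit_holds (eq_holds g) l].
have hp : complete_atomic_type (Th_forall B) p.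
  split; first by exists C, g.
  move=> q [M [a [_ aq]]] pq; apply/seteqP; split=> // l ql.
  apply: contrapT; case: l ql => e qe /= ne.
    by apply: (aq (Neg e)); [exact: pq|exact: (aq (Pos e))].
  by apply: (aq (Neg e) qe); apply: (aq (Pos e)); apply: pq; exact: contrapT.
by exists n, p, hp; apply/isomorphic_quotP; exists g.
Qed.

(** The generators have the same relations as a realization [a] of the type in a model [M], so [C]
    embeds into [M], and universal sentences pass down along embeddings. *)
Lemma defined_by_type_Th_forall B C :
  defined_by_type (Th_forall B) C -> Th_forall B `<=` Th_forall C.
Proof.
move=> [n [p [hp /isomorphic_quotP[g [ggen gp]]]]].
have [M [a [[_ BM] pE]]] := complete_atomic_typeE hp.
have gaP t s : eval g t = eval g s <-> eval a t = eval a s.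
  by rewrite gp /theta_type pE.
apply: subset_trans BM _; apply: embeds_Th_forall.
have [t s /gaP//|h [hh hE]] := hom_of_generators ggen (b := a).
exists h; split=> // x y; have [t <-] := ggen x; have [s <-] := ggen y.
by rewrite !hE => /gaP.
Qed.

End AtomicTypes.

(** * From discrimination back to compactness *)

Section Compactness.
Variables (L : language) (B : algebra L).

Lemma ultrapower_discriminated_u_omega_compact :
  (forall C : algebra L, inhabited C -> finitely_generated C ->
     embeds_in_ultrapower C B -> discriminated C B) ->
  inhabited B -> u_omega_compact B.
Proof.
move=> BC [b0] n S m e Se.
(* Without terms there are no equations and [S] is empty; otherwise [t0] serves as a default
   below. *)
have [[t0]|noterm] := pselect (inhabited (term L 'I_n)); last first.
  exists S; split=> //; suff -> : S = set0 by exact: finite_set0.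
  by apply/seteqP; split=> // -[t s] _; apply: noterm.
apply: contrapT => ncomp.
pose Phi := (fun e => QEq e.1 e.2) @` S `|` range (fun i => QNot (QEq (e i).1 (e i).2)).
have [F Ffin FPhi|J [U [hU [a aPhi]]]] := @finitely_satisfiable L B 'I_n Phi.
  (* [dec] reads the equation off a formula, with a default on formulas of other shapes; [S0] is
     thus a finite part of [S] containing every member of [S] that occurs in [F]. *)
  pose dec (f : qformula L 'I_n) := if f is QEq t s then (t, s) else (t0, t0).
  pose S0 := S `&` (dec @` F).
  apply: contrapT => nb; apply: ncomp; exists S0; split; last 2 first.
  - by move=> ? [].
  - move=> b bS0; apply: contrapT => be; apply: nb; exists b => f Ff.
    have [[e' e'S ef]|[i _ ef]] := FPhi f Ff; rewrite -ef /=.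
      by apply: bS0; split=> //; exists f => //; rewrite -ef; case: (e').
    by move=> bi; apply: be; exists i => // _ ->.
  - by apply: sub_finite_set (finite_image dec Ffin) => ? [].
(* The subalgebra of the ultrapower generated by [a] is taken as the quotient of the term algebra by
   the kernel of evaluation. *)
pose R (t s : term_algebra L 'I_n) := eval a t = eval a s.
have cR : congruence R.
  split; first by split=> [t|t s|t s r]; rewrite /R => // -> .
  move=> F u v /funext uv.
  exact: (congr1 (@finterp L (ultrapower B hU) F) uv).
pose C := quot_algebra cR.
have [|g [ggen gR]] := (isomorphic_quotP C cR).1.
  by exists id; split; [split|exists id].
have Cemb : embeds_in_ultrapower C B.
  exists J, U, hU.
  have [t s /gR//|h [hh hE]] := hom_of_generators ggen (b := a).
  exists h; split=> // x y; have [t <-] := ggen x; have [s <-] := ggen y.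
  by rewrite !hE => /gR.
have C0 : inhabited C by exists; exact: (eval g t0).
have /(discriminatedP _ ggen) Csep : discriminated C B.
  by apply: BC => //; apply/finitely_generatedP; exists n, g.
(* The point [b] solves [S] but none of the [e i], contrary to [Se]. *)
have [||b [gb be]] := Csep (range e).
- exact/finite_image/finite_finset.
- by move=> _ [i _ <-] /gR; apply: (aPhi (QNot (QEq _ _))); right; exists i.
have [|i _ bi] := Se b.
  move=> e' e'S; apply: gb; apply/gR; apply: (aPhi (QEq e'.1 e'.2)).
  by left; exists e'.
by apply: (be (e i)); [exists i|exact: bi].
Qed.

End Compactness.

(** * Truth in a limit algebra is decided at a single stage *)

Section LimitTheory.
Variables (L : language) (D : direct_system L).

Definition diagram_model (A : algebra L) (X : Type)
    (f : set (literal (diagram_atom L X))) (a : X -> A) : Prop :=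
  forall l, f l -> lit_holds (diagram_atom_holds a) l.

Lemma ds_bound n (f : 'I_n -> ds_index D) : exists k, forall l, ds_le (f l) k.
Proof.
elim: n f => [|n IHn] f; first by case: (ds_inhabited D) => k; exists k => -[].
have [k fk] := IHn (f \o lift ord0).
have [m [f0m km]] := ds_directed (f ord0) k.
exists m => l; case: (unliftP ord0 l) => [l' ->|-> //].
exact: ds_trans (fk l') km.
Qed.

Variables (n : nat) (i0 : ds_index D) (b : 'I_n -> ds_var i0).

Let lim_b : 'I_n -> limit_algebra D := fun l => dlim_in (b l).

(** Induction on [t] finds a stage beyond which the computation of [t] is recorded by positive
    conjuncts; a realization of any later formula has to follow it. *)
Lemma eval_limit (t : term L 'I_n) :
  exists p : {i : ds_index D & ds_var i},
    [/\ ds_le i0 (tag p), eval lim_b t = dlim_in (tagged p) &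
    forall j (pj : ds_le (tag p) j) (i0j : ds_le i0 j) (A : algebra L)
      (a : ds_var j -> A), diagram_model (@ds_formula L D j) a ->
      eval (fun l => a (ds_map i0j (b l))) t = a (ds_map pj (tagged p))].
Proof.
elim: t => [l|c|F u /choice[p pP]].
- exists (Tagged (fun i => ds_var (d := D) i) (b l)); split=> //=.
    exact: ds_refl.
  (* [ds_map] takes the proof of [ds_le] as an argument, and any two such proofs are equal. *)
  by move=> j pj i0j A a _; rewrite (Prop_irrelevance pj i0j).
- have [i [x cx]] := ds_cst_ex D c; have [k [ik i0k]] := ds_directed i i0.
  exists (Tagged (fun i => ds_var (d := D) i) (ds_map ik x)); split=> //=.
    by apply/limit_cstE; exists i, x; rewrite dlim_in_map.
  move=> j kj i0j A a aj; rewrite (ds_map_comp ik kj (ds_trans ik kj)).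
  exact: (aj _ (ds_formula_sub (ds_trans ik kj) cx)).
have [k pk] := ds_bound (tag \o p).
have [j [kj [y0 Fy]]] := ds_fun_ex (fun l => ds_map (pk l) (tagged (p l))).
have [m [jm i0m]] := ds_directed j i0.
exists (Tagged (fun i => ds_var (d := D) i) (ds_map jm y0)); split=> //=.
  apply/limit_funE; exists j, (ds_map kj \o (fun l => ds_map (pk l) (tagged (p l)))), y0.
  split=> // [l|]; last exact: dlim_in_map.
  by rewrite /= !dlim_in_map; have [_ -> _] := pP l.
move=> q mq i0q A a aq; rewrite (ds_map_comp jm mq (ds_trans jm mq)).
rewrite -(aq _ (ds_formula_sub (ds_trans jm mq) Fy)) /=; congr finterp.
apply/funext => l /=; have [_ _] := pP l.
have pq := ds_trans (ds_trans (pk l) kj) (ds_trans jm mq).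
move=> /(_ q pq i0q A a aq) ->.
by rewrite (ds_map_comp _ _ (ds_trans (pk l) kj)) (ds_map_comp _ _ pq).
Qed.

(** The two sides of an equation true in the limit become the same variable at some stage. If it is
    false they stay distinct variables, and a diagram-formula forces these to take distinct
    values. *)
Lemma qsat_limit (f : qformula L 'I_n) :
  exists i, ds_le i0 i /\
    forall j, ds_le i j -> forall (i0j : ds_le i0 j) (A : algebra L)
      (a : ds_var j -> A), diagram_model (@ds_formula L D j) a ->
      qsat (fun l => a (ds_map i0j (b l))) f <-> qsat lim_b f.
Proof.
elim: f => [t s|f [i [i0i IHf]]|f [i [i0i IHf]] g [j [i0j IHg]]
           |f [i [i0i IHf]] g [j [i0j IHg]]].
- have [p [i0p tp pP]] := eval_limit t; have [q [i0q sq qP]] := eval_limit s.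
  have [pq|npq] := pselect (dlim_in (tagged p) = dlim_in (tagged q)).
    have /dlim_inP[k [pk [qk epq]]] := pq.
    exists k; split=> [|j kj i0j A a aj /=]; first exact: ds_trans i0p pk.
    rewrite tp sq (pP _ (ds_trans pk kj))// (qP _ (ds_trans qk kj))//.
    by rewrite -(ds_map_comp pk kj) epq (ds_map_comp qk kj (ds_trans qk kj)).
  have [k [pk qk]] := ds_directed (tag p) (tag q).
  exists k; split=> [|j kj i0j A a aj /=]; first exact: ds_trans i0p pk.
  rewrite tp sq (pP _ (ds_trans pk kj))// (qP _ (ds_trans qk kj))//.
  split=> // apq; exfalso.
  have [_ _ neq _ _] := ds_diagram (d := D) j.
  have ne : ds_map (ds_trans pk kj) (tagged p) <> ds_map (ds_trans qk kj) (tagged q).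
    by move=> e; apply: npq; apply/dlim_inP; exists j, (ds_trans pk kj), (ds_trans qk kj).
  exact: (aj _ (neq _ _ ne)).
- by exists i; split=> // j ij i0j A a aj /=; rewrite IHf.
- have [k [ik jk]] := ds_directed i j.
  exists k; split=> [|l kl i0l A a al /=]; first exact: ds_trans ik.
  by rewrite IHf ?IHg//; [exact: ds_trans jk kl|exact: ds_trans ik kl].
- have [k [ik jk]] := ds_directed i j.
  exists k; split=> [|l kl i0l A a al /=]; first exact: ds_trans ik.
  by rewrite IHf ?IHg//; [exact: ds_trans jk kl|exact: ds_trans ik kl].
Qed.

End LimitTheory.

(** A finite tuple of the limit comes from one stage; the realization in [B] of the formula of a
    late enough stage carries the truth of [f] over to [B]. *)
Lemma limit_algebra_over_Th_exists (L : language) (B C : algebra L) :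
  limit_algebra_over B C -> Th_exists C `<=` Th_exists B.
Proof.
move=> [D [Bsat [h [hh hbij]]]].
apply: (@subset_trans _ (Th_exists (limit_algebra D))).
  apply/Th_forall_existsP/embeds_Th_forall.
  by exists h; split=> //; exact: bij_inj.
move=> [n f] [a af]; have [i0 [b ab]] := dlim_in_bound a.
have [i [i0i fi]] := qsat_limit b f.
have [c cB] := Bsat i.
exists (fun l => c (ds_map i0i (b l))).
apply/(fi i (ds_refl i) i0i B c cB).
by have -> : (fun l => dlim_in (b l)) = a by apply/funext => l; rewrite ab.
Qed.

(** * Finite diagrams as quantifier-free formulas *)

Section Diagrams.
Variables (L : language) (X : Type).

Definition literal_formula (l : literal (diagram_atom L X)) : qformula L X :=
  let atom d := match d with
    | DFun F y y0 => QEq (App F (Var \o y)) (Var y0)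
    | DCst c y0 => QEq (Cst c) (Var y0)
    | DEq y y' => QEq (Var y) (Var y')
    end in
  match l with Pos d => atom d | Neg d => QNot (atom d) end.

Lemma literal_formulaP (A : algebra L) (a : X -> A) l :
  qsat a (literal_formula l) <-> lit_holds (diagram_atom_holds a) l.
Proof. by case: l => -[]. Qed.

Lemma discriminated_satisfiable (B C : algebra L) (x0 : X)
    (f : set (literal (diagram_atom L X))) :
  discriminated C B -> finite_set f -> satisfiable_in C f -> satisfiable_in B f.
Proof.
move=> CB ffin [a af].
have [g gf] := finite_conjunction (Var x0) (finite_image literal_formula ffin).
have [W [Wfin Wg]] := qsat_local a g.
have [h [hh hinj]] := CB W Wfin; exists (h \o a) => l fl.
apply/literal_formulaP; apply: (gf _ _).1; last by exists l.
by apply/Wg => //; apply/gf => _ [l' fl' <-]; apply/literal_formulaP/af.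
Qed.

End Diagrams.

Lemma finite_sublanguage_literals (L : language) (X : finType)
    (Lc : set (cst_sym L)) (Lf : set (fun_sym L)) :
  finite_set Lc -> finite_set Lf ->
  finite_set [set l : literal (diagram_atom L X) | in_sublanguage Lc Lf (lit_atom l)].
Proof.
move=> Lcfin Lffin; pose S : set (diagram_atom L X) := in_sublanguage Lc Lf.
suff Sfin : finite_set S.
  apply: (@sub_finite_set _ _ (Pos @` S `|` Neg @` S)).
    by move=> [] d dS; [left|right]; exists d.
  by rewrite finite_setU; split; exact: finite_image.
(* Argument tuples are taken as finite functions, which form a [finType]. *)
pose SF F := range (fun p : {ffun 'I_(arity F) -> X} * X => @DFun L X F p.1 p.2).
pose Sc (c : cst_sym L) := range (@DCst L X c).
pose SE := range (fun p : X * X => @DEq L X p.1 p.2).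
apply: (@sub_finite_set _ _ (\bigcup_(F in Lf) SF F `|` \bigcup_(c in Lc) Sc c `|` SE)).
  move=> [F y y0 FL|c y cL|y y' _].
  - left; left; exists F => //; exists (finfun y, y0) => //=.
    by congr DFun; apply/funext => i; rewrite ffunE.
  - by left; right; exists c => //; exists y.
  - by right; exists (y, y').
rewrite !finite_setU; split; first split.
- by apply: bigcup_finite => // F _; exact/finite_image/finite_finset.
- by apply: bigcup_finite => // c _; exact/finite_image/finite_finset.
- exact/finite_image/finite_finset.
Qed.

(** * An algebra as the limit of its finite diagrams *)

Section FiniteDiagrams.
Local Open Scope fset_scope.
Variables (L : language) (C : algebra L) (c0 : C).

(** A stage selects finitely many elements of [C], constants and function symbols. Its variables are
    elements of [C], and its formula collects all literals of the sublanguage true of them. *)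
Let I : Type := ({fset {classic C}} * {fset {classic cst_sym L}} *
  {fset {classic fun_sym L}})%type.
Let le (i j : I) : Prop :=
  [/\ i.1.1 `<=` j.1.1, i.1.2 `<=` j.1.2 & i.2 `<=` j.2].
Let Lc (i : I) : set (cst_sym L) := [set c | (c : {classic _}) \in i.1.2].
Let Lf (i : I) : set (fun_sym L) := [set F | (F : {classic _}) \in i.2].

(* The base point c0 is added because the sets of variables of a direct system
   are nonempty. *)
Let support (i : I) : {fset {classic C}} := (c0 : {classic C}) |` i.1.1.
Let V (i : I) : finType := support i.
Let val_V i (x : V i) : C := fsval x.
Let diag i : set (literal (diagram_atom L (V i))) :=
  [set l | in_sublanguage (Lc i) (Lf i) (lit_atom l) /\
           lit_holds (diagram_atom_holds (@val_V i)) l]%classic.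

Let support_sub i j : le i j -> support i `<=` support j.
Proof. by move=> [ij _ _]; exact: fsetUS. Qed.

Let incl i j (h : le i j) : V i -> V j := fincl (support_sub h).

Let val_incl i j (h : le i j) x : val_V (incl h x) = val_V x.
Proof. by []. Qed.

Let val_V_inj i : injective (@val_V i).
Proof. exact: val_inj. Qed.

Let le_refl i : le i i. Proof. by split. Qed.

Let le_antisym i j : le i j -> le j i -> i = j.
Proof.
case: i j => [[a b] c] [[a' b'] c'] [/= aa bb cc] [/= aa' bb' cc'].
by congr (_, _, _); apply/eqP; rewrite eqEfsubset; apply/andP.
Qed.

Let le_trans i j k : le i j -> le j k -> le i k.
Proof.
move=> [ij ij' ij''] [jk jk' jk''].
by split; [apply: fsubset_trans jk|apply: fsubset_trans jk'|apply: fsubset_trans jk''].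
Qed.

Let le_directed i j : exists k, le i k /\ le j k.
Proof.
exists (i.1.1 `|` j.1.1, i.1.2 `|` j.1.2, i.2 `|` j.2).
by split; split=> /=; rewrite ?fsubsetUl ?fsubsetUr.
Qed.

Let Lc_finite i : finite_set (Lc i). Proof. exact: (finite_fset i.1.2). Qed.
Let Lf_finite i : finite_set (Lf i). Proof. exact: (finite_fset i.2). Qed.

Let V_gt0 i : 0 < #|V i|.
Proof.
have c0i : (c0 : {classic C}) \in support i by rewrite fset1U1.
by apply/card_gt0P; exists [` c0i].
Qed.

Let diag_finite i : finite_set (@diag i).
Proof.
apply: sub_finite_set (finite_sublanguage_literals (V i) (Lc_finite i) (Lf_finite i)).
by move=> l [].
Qed.

Let diag_diagram i : diagram_formula (Lc i) (Lf i) (@diag i).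
Proof.
split=> [|l []//|y y' yy'|F y y0 FL|c y cL]; first exact: diag_finite.
- by split=> //= /val_V_inj.
- by have [Fy|Fy] := pselect (diagram_atom_holds (@val_V i) (DFun F y y0));
     [left|right].
- by have [cy|cy] := pselect (diagram_atom_holds (@val_V i) (DCst c y));
     [left|right].
Qed.

Let diag_satisfiable i : satisfiable_in C (@diag i).
Proof. by exists (@val_V i) => l []. Qed.

Let incl_id i (h : le i i) x : incl h x = x.
Proof. by apply: val_V_inj; rewrite val_incl. Qed.

Let incl_comp i j k (hij : le i j) (hjk : le j k) (hik : le i k) x :
  incl hjk (incl hij x) = incl hik x.
Proof. by apply: val_V_inj; rewrite !val_incl. Qed.

Let Lc_sub i j : le i j -> (Lc i `<=` Lc j)%classic.
Proof. by move=> [_ /fsubsetP ij _] c; exact: ij. Qed.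

Let Lf_sub i j : le i j -> (Lf i `<=` Lf j)%classic.
Proof. by move=> [_ _ /fsubsetP ij] F; exact: ij. Qed.

Let diag_sub i j (h : le i j) l :
  @diag i l -> @diag j (lit_map (diagram_atom_map (incl h)) l).
Proof.
by move=> []; case: l => -[F y y0|c y|y y'] /= lL ly; split=> //=;
   [exact: Lf_sub lL|exact: Lc_sub lL|exact: Lf_sub lL|exact: Lc_sub lL].
Qed.

Let diag_cst_ex c : exists i (x : V i), @diag i (Pos (DCst c x)).
Proof.
pose i : I := ([fset (cinterp C c : {classic C})], [fset (c : {classic _})], fset0).
have ci : (cinterp C c : {classic C}) \in support i.
  by rewrite in_fset1U inE eqxx orbT.
by exists i, [` ci]; split=> //=; rewrite /Lc /= inE.
Qed.

Let diag_fun_ex (F : fun_sym L) i (y : 'I_(arity F) -> V i) :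
  exists j (h : le i j) (y0 : V j), @diag j (Pos (DFun F (incl h \o y) y0)).
Proof.
pose z : {classic C} := finterp C F (@val_V i \o y).
pose j : I := (z |` i.1.1, i.1.2, (F : {classic _}) |` i.2).
have ij : le i j by split=> //=; exact: fsubsetU1.
have zj : z \in support j by rewrite in_fset1U fset1U1 orbT.
by exists j, ij, [` zj]; split=> //=; rewrite /Lf /= fset1U1.
Qed.

Definition finite_diagrams : direct_system L :=
  @DirectSystem L I le (inhabits (fset0, fset0, fset0)) le_refl le_antisym
    le_trans le_directed Lc Lf Lc_finite Lf_finite V V_gt0 diag diag_diagram
    (fun i => ex_intro _ C (conj (inhabits c0) (diag_satisfiable i)))
    incl incl_id incl_comp Lc_sub Lf_sub
    diag_sub diag_cst_ex diag_fun_ex.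

(** The transition maps keep the underlying element of [C], so variables are identified in the limit
    exactly when they are the same element; stages built on singletons reach every element. *)
Lemma finite_diagrams_limit : isomorphic (limit_algebra finite_diagrams) C.
Proof.
pose k (z : limit_algebra finite_diagrams) : C :=
  val_V (i := tag (quot_repr z)) (tagged (quot_repr z)).
have dlimE i j (x : V i) (y : V j) :
    dlim_in (D := finite_diagrams) (i := i) x =
    dlim_in (D := finite_diagrams) (i := j) y <-> val_V x = val_V y.
  split=> [/dlim_inP[m [im [jm /(congr1 (@val_V m))]]] //|xy].
  have [m [im jm]] := le_directed i j.
  by apply/dlim_inP; exists m, im, jm; exact: val_V_inj.
have kE i (x : V i) : k (dlim_in (D := finite_diagrams) (i := i) x) = val_V x.
  apply/dlimE; rewrite -[RHS]quot_reprK /dlim_in.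
  by case: (quot_repr _).
exists k; split; first split.
- move=> c; have [i [x [[_ /= cx] ->]]] := (@limit_cstE L finite_diagrams c _).1 erefl.
  by rewrite kE cx.
- move=> F u; have [i [y [y0 [[_ /= Fy] uy ->]]]] :=
    (@limit_funE L finite_diagrams F u _).1 erefl.
  rewrite kE -Fy; congr finterp; apply/funext => l /=.
  by rewrite uy kE.
have /choice[g kg] (c : C) : exists z, k z = c.
  have cP : (c : {classic C}) \in support ([fset (c : {classic C})], fset0, fset0).
    by rewrite in_fset1U inE eqxx orbT.
  by exists (dlim_in (D := finite_diagrams) (i := (_, _, _)) [` cP]); rewrite kE.
exists g => // z; have [i [x zx]] := dlim_in_surj (g (k z)).
have [j [y zy]] := dlim_in_surj z.
by rewrite zx [RHS]zy; apply/dlimE; rewrite -!kE -zx -zy.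
Qed.

Lemma discriminated_limit_algebra_over (B : algebra L) :
  discriminated C B -> limit_algebra_over B C.
Proof.
move=> CB; exists finite_diagrams; split; last first.
  exact/isomorphic_sym/finite_diagrams_limit.
move=> i; have c0i : (c0 : {classic C}) \in support i by rewrite fset1U1.
exact: (discriminated_satisfiable [` c0i] CB (diag_finite i) (diag_satisfiable i)).
Qed.

End FiniteDiagrams.

(** * The cycle of implications and the converse *)

Theorem theorem3p4 (L : language) (B : algebra L) (hB : inhabited B) :
  let conditions_equivalent (C : algebra L) : Prop :=
    [<-> Th_forall B `<=` Th_forall C;
         Th_exists C `<=` Th_exists B;
         embeds_in_ultrapower C B;
         discriminated C B;
         limit_algebra_over B C;
         defined_by_type (Th_forall B) C;
         irreducible_coordinate_algebra B C] in
  (u_omega_compact B ->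
     forall C : algebra L, inhabited C -> finitely_generated C ->
       conditions_equivalent C) /\
  ((forall C : algebra L, inhabited C -> finitely_generated C ->
       conditions_equivalent C) ->
     u_omega_compact B).
Proof.
split=> [Bcomp C [c0] Cfg|BC].
  have C0 : inhabited C by exists.
  (* Compactness enters only here; it serves the passages from ultrapowers to discrimination and
     from atomic types to coordinate algebras. *)
  have discr := u_omega_compact_discriminated Bcomp C0 Cfg.
  tfae.
  - by move=> /Th_forall_existsP.
  - exact: Th_exists_embeds_in_ultrapower.
  - move=> [J [U [hU CU]]]; apply: discr.
    apply: (@subset_trans _ (Th_exists (ultrapower B hU))).
      exact/Th_forall_existsP/embeds_Th_forall.
    exact: ultrapower_Th_exists.
  - exact: discriminated_limit_algebra_over.
  - move=> /limit_algebra_over_Th_exists/Th_forall_existsP.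
    exact: Th_forall_defined_by_type.
  - move=> /defined_by_type_Th_forall/Th_forall_existsP/discr.
    by move/(discriminated_irreducibleP _ Cfg).
  - move=> /(discriminated_irreducibleP _ Cfg)/discriminated_Th_exists.
    by move/Th_forall_existsP.
apply: ultrapower_discriminated_u_omega_compact => // C C0 Cfg.
(* Conditions are counted from 0: [2] is the embedding into an ultrapower and [3] is
   discrimination. *)
exact: (BC C C0 Cfg 2 3).1.
Qed.
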